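(* For $n\ge1$, $$\sum_{\pi\in\mathfrak{S}_n(213)}t^{\mathsf{des}\,\pi}q^{\mathsf{adi}\,\pi}=\sum_{\pi\in\mathfrak{S}_n(132)}t^{\mathsf{des}\,\pi}q^{\mathsf{adi}^*\,\pi}=\sum_{k=0}^{\lfloor (n-1)/2\rfloor}\Big(\sum_{\pi\in\widetilde{\mathfrak{S}}_{n,k}(213)}q^{\mathsf{adi}\,\pi}\Big)t^k(1+t)^{n-1-2k}=\sum_{k=0}^{\lfloor (n-1)/2\rfloor}\Big(\sum_{\pi\in\widetilde{\mathfrak{S}}_{n,k}(132)}q^{\mathsf{adi}^*\,\pi}\Big)t^k(1+t)^{n-1-2k}.$$
   Context: $\mathfrak{S}_n(\tau)$: permutations of $[n]$ avoiding the classical pattern $\tau$. $\mathsf{des}\,\pi=\#\{i\in[n-1]:\pi(i)>\pi(i+1)\}$. Admissible inversions: set $\pi(n+1)=0$; an inversion pair $(\pi(i),\pi(j))$ ($1\le i<j\le n$, $\pi(i)>\pi(j)$) is admissible if $\pi(j)<\pi(j+1)$ or there is $l$ with $i<l<j$ and $\pi(l)<\pi(j)$; $\mathsf{adi}\,\pi$ counts them. Star admissible: set $\pi(0)=n+1$; an inversion pair $(\pi(i),\pi(j))$ with $i<j$ is star admissible if $\pi(i-1)<\pi(i)$ or there is $l$ with $i<l<j$ and $\pi(l)>\pi(i)$; $\mathsf{adi}^*\,\pi$ counts them. $\mathsf{dd}\,\pi$ is the number of $i\in[n]$ with $\pi(i-1)>\pi(i)>\pi(i+1)$ under $\pi(0)=\pi(n+1)=0$;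 $\mathsf{dd}^*\,\pi$ is the same with $\pi(0)=\pi(n+1)=n+1$. $\widetilde{\mathfrak{S}}_{n,k}(213)=\{\pi\in\mathfrak{S}_n(213):\mathsf{dd}\,\pi=0,\mathsf{des}\,\pi=k\}$, $\widetilde{\mathfrak{S}}_{n,k}(132)=\{\pi\in\mathfrak{S}_n(132):\mathsf{dd}^*\,\pi=0,\mathsf{des}\,\pi=k\}$. *)

(* Defs.v *)
(* Permutations of [n] are represented by s : 'S_n = {perm 'I_n};
   the one-line value pi(i) (i in 1..n) is (s (i-1)).+1, so values lie in 1..n. *)
From HB Require Import structures.
From mathcomp Require Import all_boot all_order all_algebra all_fingroup.
Set Implicit Arguments. Unset Strict Implicit. Unset Printing Implicit Defensive.

(* pv s b i = pi(i) for 1 <= i <= n, and the boundary value b otherwise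
   (used for the conventions pi(0), pi(n+1)). *)
Definition pv (n : nat) (s : 'S_n) (b i : nat) : nat :=
  if i is i'.+1 then oapp (fun j : 'I_n => (val (s j)).+1) b (insub i') else b.

Definition contains (n : nat) (s : 'S_n) (tau : seq nat) : bool :=
  [exists f : {ffun 'I_(size tau) -> 'I_n},
     [forall a : 'I_(size tau), forall b : 'I_(size tau),
        ((a < b) ==> (f a < f b)) &&
        ((val (s (f a)) < val (s (f b))) == (nth 0 tau a < nth 0 tau b))]].

Definition avoids (n : nat) (s : 'S_n) (tau : seq nat) : bool := ~~ contains s tau.

Definition des (n : nat) (s : 'S_n) : nat :=
  \sum_(1 <= i < n) (pv s 0 i.+1 < pv s 0 i : nat).

(* admissible inversions, with pi(n+1) = 0 *)
Definition adi (n : nat) (s : 'S_n) : nat :=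
  let p := pv s 0 in
  \sum_(1 <= i < n.+1) \sum_(i.+1 <= j < n.+1)
     ([&& p j < p i &
          (p j < p j.+1) || has (fun l => p l < p j) (index_iota i.+1 j)] : nat).

(* star admissible inversions, with pi(0) = n+1 *)
Definition adi_star (n : nat) (s : 'S_n) : nat :=
  let p := pv s n.+1 in
  \sum_(1 <= i < n.+1) \sum_(i.+1 <= j < n.+1)
     ([&& p j < p i &
          (p i.-1 < p i) || has (fun l => p i < p l) (index_iota i.+1 j)] : nat).

(* double descents with pi(0) = pi(n+1) = 0 *)
Definition dd (n : nat) (s : 'S_n) : nat :=
  let p := pv s 0 in
  \sum_(1 <= i < n.+1) ([&& p i < p i.-1 & p i.+1 < p i] : nat).

(* double descents with pi(0) = pi(n+1) = n+1 *)
Definition dd_star (n : nat) (s : 'S_n) : nat :=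
  let p := pv s n.+1 in
  \sum_(1 <= i < n.+1) ([&& p i < p i.-1 & p i.+1 < p i] : nat).

Definition Stilde213 (n k : nat) (s : 'S_n) : bool :=
  [&& avoids s [:: 2; 1; 3]%N, dd s == 0 & des s == k].

Definition Stilde132 (n k : nat) (s : 'S_n) : bool :=
  [&& avoids s [:: 1; 3; 2]%N, dd_star s == 0 & des s == k].

(* Main.v *)
Require Import Defs.
From HB Require Import structures.
From mathcomp Require Import all_boot all_order all_algebra all_fingroup.
From mathcomp Require Import zify ring.
Import GRing.Theory.
Set Implicit Arguments. Unset Strict Implicit. Unset Printing Implicit Defensive.

(** Reverse-complementation maps 213-avoiders to 132-avoiders, preserves [des]
    and turns [adi], [dd] into [adi_star], [dd_star]; hence only the first and
    third expressions must be compared. A 213-avoiding word with minimum [m] is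
    [u ++ m :: v] with [u], [v] 213-avoiding and every letter of [u] larger than
    every letter of [v]. With [l], [r] the lengths of [u], [v],
      des = des u + des v + [l > 0],   dd = dd u + dd v + [l > 0 and r = 0],
      adi = adi u + adi v + l (r + [r > 0]).
    So both generating functions satisfy
      X_(n+1) = (1 + t) X_n + t \sum_(l + r = n; l, r > 0) q^(l (r + 1)) X_l X_r
    for [n >= 1]: for the first one [1] and [t] come from the terms [l = 0] and
    [r = 0]; for the gamma expansion [1 + t] comes from [l = 0] alone, since the
    terms with [r = 0 < l] have a double descent. *)

(** * Descents, double descents and admissible inversions of words *)

(* The default [x] in [head x w'] makes the last letter contribute nothing. *)
Fixpoint wdes (w : seq nat) : nat :=
  if w is x :: w' then (head x w' < x) + wdes w' else 0.

(* The word is preceded by the letter [a] and followed by [0]. *)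
Fixpoint wdd (a : nat) (w : seq nat) : nat :=
  if w is x :: w' then ((x < a) && (head 0 w' < x)) + wdd x w' else 0.

(* Number of letters [y] of [w] forming an admissible inversion with an earlier [x],
   where [s] collects the letters between [x] and [w]. *)
Fixpoint wadi_from (x : nat) (s w : seq nat) : nat :=
  if w is y :: w' then
    ((y < x) && ((y < head 0 w') || has (ltn^~ y) s)) + wadi_from x (y :: s) w'
  else 0.

Fixpoint wadi (w : seq nat) : nat :=
  if w is x :: w' then wadi_from x [::] w' + wadi w' else 0.

Lemma wdes_cat (u v : seq nat) (y : nat) :
  wdes (u ++ y :: v) = wdes u + (y < last y u) + wdes (y :: v).
Proof.
elim: u => [|x [|x' u] IH] /=; first by rewrite ltnn.
  by rewrite ltnn.
by move: IH => /= ->; rewrite !addnA.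
Qed.

Lemma ltn_last (a m : nat) (w : seq nat) : a <= m -> all (ltn m) w ->
  (m < last a w) = (0 < size w).
Proof.
case: w => [|x w] am mw /=; first by rewrite ltnNge am.
exact: allP mw _ (mem_last x w).
Qed.

Lemma wdes_cat_min (m : nat) (u v : seq nat) : all (ltn m) (u ++ v) ->
  wdes (u ++ m :: v) = wdes u + wdes v + (0 < size u).
Proof.
rewrite all_cat wdes_cat => /andP[mu mv]; rewrite ltn_last // -addnA addnAC -addnA.
congr (_ + (_ + _)).
by case: v mv => [|y v] /=; rewrite ?ltnn // => /andP[my _]; rewrite ltnNge ltnW.
Qed.

Lemma wdd_cat (a y : nat) (u v : seq nat) :
  all (ltn y) u -> wdd a (u ++ y :: v) = wdd a u + wdd (last a u) (y :: v).
Proof.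
elim: u a => [|x u IH] a //= /andP[yx yu]; rewrite IH // -addnA; congr (_ + _).
by case: u {IH} yu => //= _; rewrite yx (leq_ltn_trans _ yx).
Qed.

Lemma wdd_cat_min (m : nat) (u v : seq nat) : 0 < m -> all (ltn m) (u ++ v) ->
  wdd 0 (u ++ m :: v) = wdd 0 u + wdd 0 v + ((0 < size u) && (size v == 0)).
Proof.
move=> m_gt0; rewrite all_cat => /andP[mu mv]; rewrite wdd_cat //= ltn_last //.
case: v mv => [|x v] /=; first by rewrite m_gt0 !addn0.
by case/andP=> mx _; rewrite [x < m]ltnNge (ltnW mx) !andbF addn0.
Qed.

(* A descent into [x] from [a] leaves no room for a descent out of [x]: without
   double descents, descents are pairwise non-adjacent. *)
Lemma double_wdes_cons_lt_size (a x : nat) (w : seq nat) : all (ltn 0) (x :: w) ->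
  wdd a (x :: w) = 0 -> (wdes (x :: w)).*2 + (x < a) < size (x :: w).
Proof.
elim: w a x => [|y w IH] a x; first by move=> /=; lia.
by case/andP=> x_gt0 yw_gt0; have := IH x y yw_gt0; move: x_gt0 => /=; lia.
Qed.

Lemma double_wdes_lt_size (w : seq nat) : w != [::] -> all (ltn 0) w ->
  wdd 0 w = 0 -> (wdes w).*2 < size w.
Proof.
by case: w => // x w _ /double_wdes_cons_lt_size xw /xw; rewrite ltn0 addn0.
Qed.

Lemma wadi_from_bottom (x : nat) (s w : seq nat) :
  all (leq x) w -> wadi_from x s w = 0.
Proof. by elim: w s => //= y w IH s /andP[xy /IH->]; rewrite ltnNge xy. Qed.

Lemma wadi_from_below (x m : nat) (s w : seq nat) :
  m \in s -> all (fun y => m < y < x) w -> wadi_from x s w = size w.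
Proof.
elim: w s => //= y w IH s ms /andP[/andP[my yx] /IH->]; last by rewrite inE ms orbT.
by rewrite yx (introT hasP) ?orbT //; exists m.
Qed.

Lemma wadi_from_cat_min (x m : nat) (s u v : seq nat) :
    m < x -> all (ltn m) (s ++ u ++ v) -> all (ltn^~ x) v ->
  wadi_from x s (u ++ m :: v) = wadi_from x s u + (size v + (0 < size v)).
Proof.
move=> mx; elim: u s => [|y u IH] s; rewrite all_cat /=.
  case/andP=> ms mv vx; rewrite mx /= (wadi_from_below (m := m)) ?mem_head //.
    rewrite [in LHS]addnC; congr (_ + nat_of_bool _).
    rewrite (_ : has _ s = false); first by case: v mv {vx} => //= y v /andP[->].
    by apply/hasPn => z /(allP ms)/ltnW; rewrite -leqNgt.
  by rewrite (eq_all (a2 := predI (ltn m) (ltn^~ x))) // all_predI mv.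
case/and3P=> ms my muv vx; rewrite IH //; last by rewrite all_cat /= my ms.
rewrite addnA; congr (_ + _ + _); case: u {IH} muv => //= _.
by rewrite [y < m]ltnNge (ltnW my).
Qed.

Lemma wadi_cons_min (m : nat) (w : seq nat) :
  all (ltn m) w -> wadi (m :: w) = wadi w.
Proof.
by move=> mw; rewrite /= wadi_from_bottom //; apply: sub_all mw => x /ltnW.
Qed.

Lemma wadi_cat_min (m : nat) (u v : seq nat) :
    all (ltn m) (u ++ v) -> allrel ltn v u ->
  wadi (u ++ m :: v) = wadi u + wadi v + size u * (size v + (0 < size v)).
Proof.
elim: u => [|x u IH] /=; first by rewrite addn0 => mv _; exact: wadi_cons_min.
rewrite allrel_consr => /andP[mx muv] /andP[vx vu].
by rewrite wadi_from_cat_min // IH //; lia.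
Qed.

(** * The words avoiding 213 *)

Fixpoint wavoids213 (w : seq nat) : bool :=
  if w is x :: w' then
    pairwise (fun y z => ~~ (y < x < z)) w' && wavoids213 w'
  else true.

Lemma all_pairwise (T : Type) (P : pred T) (r : rel T) (s : seq T) :
  (forall x y, P x -> P y -> r x y) -> all P s -> pairwise r s.
Proof.
move=> rP; elim: s => //= x s IH /andP[Px Ps]; rewrite IH // andbT.
by apply: sub_all Ps => y; exact: rP.
Qed.

Lemma wavoids213_cat_min (m : nat) (u v : seq nat) : all (ltn m) (u ++ v) ->
  wavoids213 (u ++ m :: v) = [&& wavoids213 u, wavoids213 v & allrel leq v u].
Proof.
elim: u => [|x u IH] /=.
  move=> mv; rewrite allrel0r andbT andb_idl // => _.
  apply: all_pairwise mv => y z my _.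
  by rewrite [y < m]ltnNge (ltnW my).
case/andP=> mx muv; rewrite IH // allrel_consr pairwise_cat pairwise_cons.
have -> : all (fun z => ~~ (m < x < z)) v = all (leq^~ x) v.
  by apply: eq_all => z; rewrite mx -leqNgt.
case: (boolP (all (leq^~ x) v)) => [vx|_]; last by rewrite !andbF.
have -> : allrel (fun y z => ~~ (y < x < z)) u (m :: v).
  apply/allrelP => y z _; rewrite inE => /predU1P[->|/(allP vx) zx].
    by rewrite [x < m]ltnNge (ltnW mx) andbF.
  by rewrite [x < z]ltnNge zx andbF.
have -> : pairwise (fun y z => ~~ (y < x < z)) v.
  by apply: all_pairwise vx => y z _; rewrite [x < z]ltnNge => ->; rewrite andbF.
by case: (pairwise _ u); case: (wavoids213 u); rewrite ?andbT.
Qed.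

Section SortedWords.

Variables (T : eqType) (leT : rel T).
Hypotheses (leT_total : total leT) (leT_tr : transitive leT)
  (leT_anti : antisymmetric leT).

Lemma perm_sortedE (s1 s2 : seq T) :
  sorted leT s2 -> perm_eq s1 s2 = (sort leT s1 == s2).
Proof.
move=> s2_sorted; apply/idP/eqP => [|<-]; last by rewrite perm_sym perm_sort.
by move/(perm_sortP leT_total leT_tr leT_anti)->; exact: sorted_sort.
Qed.

Lemma sort_cat_allrel (s1 s2 : seq T) :
  allrel leT s1 s2 -> sort leT (s1 ++ s2) = sort leT s1 ++ sort leT s2.
Proof.
move=> s12; apply/eqP; rewrite -perm_sortedE.
  by rewrite perm_cat // perm_sym perm_sort.
rewrite sorted_pairwise // pairwise_cat -!sorted_pairwise //.
rewrite !(sort_sorted leT_total) !andbT; apply/allrelP => x y.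
by rewrite !mem_sort; apply/allrelP.
Qed.

End SortedWords.

Lemma perm_cat_iota (m : nat) (u v : seq nat) : allrel leq u v ->
  perm_eq (u ++ v) (iota m (size u + size v)) =
  perm_eq u (iota m (size u)) && perm_eq v (iota (m + size u) (size v)).
Proof.
have permE := perm_sortedE leq_total leq_trans anti_leq.
move=> uv; rewrite !permE ?iota_sorted // iotaD.
rewrite (sort_cat_allrel leq_total leq_trans anti_leq uv).
by rewrite eqseq_cat // size_sort size_iota.
Qed.

Definition avoiders213 (n m : nat) : seq (seq nat) :=
  [seq w <- permutations (iota m n) | wavoids213 w].

Lemma mem_avoiders213 (n m : nat) (w : seq nat) :
  (w \in avoiders213 n m) = wavoids213 w && perm_eq w (iota m n).
Proof. by rewrite mem_filter mem_permutations. Qed.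

Lemma avoiders213_uniq (n m : nat) : uniq (avoiders213 n m).
Proof. exact/filter_uniq/permutations_uniq. Qed.

Lemma size_avoiders213 (n m : nat) (w : seq nat) :
  w \in avoiders213 n m -> size w = n.
Proof. by rewrite mem_avoiders213 => /andP[_ /perm_size->]; rewrite size_iota. Qed.

Lemma mem_avoiders213_bounds (n m x : nat) (w : seq nat) :
  w \in avoiders213 n m -> x \in w -> m <= x < m + n.
Proof. by rewrite mem_avoiders213 => /andP[_ /perm_mem->]; rewrite mem_iota. Qed.

Lemma allrel_avoiders213 (l m r : nat) (u v : seq nat) :
  u \in avoiders213 l (m + r) -> v \in avoiders213 r m -> allrel ltn v u.
Proof.
move=> uA vA; apply/allrelP => y x yv xu /=.
by have := mem_avoiders213_bounds uA xu; have := mem_avoiders213_bounds vA yv; lia.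
Qed.

Lemma min_mem_avoiders213 (n m : nat) (w : seq nat) :
  w \in avoiders213 n.+1 m -> m \in w.
Proof. by rewrite mem_avoiders213 => /andP[_ /perm_mem->]; rewrite mem_head. Qed.

Lemma mem_avoiders213_cat_min (m : nat) (u v : seq nat) :
  (u ++ m :: v \in avoiders213 (size u + size v).+1 m) =
  (u \in avoiders213 (size u) (m.+1 + size v)) &&
    (v \in avoiders213 (size v) m.+1).
Proof.
have permE : perm_eq (u ++ m :: v) (iota m (size u + size v).+1) =
    perm_eq (v ++ u) (iota m.+1 (size v + size u)).
  by rewrite perm_catC /= perm_cons addnC.
rewrite !mem_avoiders213 permE; apply/idP/idP.
  case/andP=> av p; have muv : all (ltn m) (u ++ v).
    apply/allP => x; rewrite mem_cat orbC -mem_cat (perm_mem p) mem_iota.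
    by case/andP.
  move: av; rewrite wavoids213_cat_min // => /and3P[-> -> vu].
  by move: p; rewrite perm_cat_iota // => /andP[-> ->].
case/andP=> /andP[avu pu] /andP[avv pv].
have vu : allrel leq v u.
  by apply/allrelP => x y; rewrite (perm_mem pv) (perm_mem pu) !mem_iota; lia.
have muv : all (ltn m) (u ++ v).
  by apply/allP => x; rewrite mem_cat (perm_mem pv) (perm_mem pu) !mem_iota /=; lia.
by rewrite perm_cat_iota // pu pv wavoids213_cat_min // avu avv vu.
Qed.

Lemma perm_avoiders213_index (m l r : nat) :
  perm_eq [seq w <- avoiders213 (l + r).+1 m | index m w == l]
    [seq u ++ m :: v | u <- avoiders213 l (m.+1 + r), v <- avoiders213 r m.+1].
Proof.
apply: uniq_perm; first exact/filter_uniq/avoiders213_uniq.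
  apply: allpairs_uniq; try exact: avoiders213_uniq.
  move=> _ _ /allpairsP[[u v] [/= uA _ ->]] /allpairsP[[u' v'] [/= uA' _ ->]] /eqP.
  rewrite eqseq_cat; last by rewrite (size_avoiders213 uA) (size_avoiders213 uA').
  by case/andP=> /eqP-> /eqP[->].
move=> w; rewrite mem_filter; apply/andP/allpairsP => [[/eqP iw wA]|].
  have mw := min_mem_avoiders213 wA.
  have lw : l < size w by rewrite -iw index_mem.
  have wE : take l w ++ m :: drop l.+1 w = w.
    by rewrite -{1}(nth_index m mw) iw -drop_nth ?cat_take_drop.
  have lE : size (take l w) = l by rewrite size_takel // ltnW.
  have rE : size (drop l.+1 w) = r.
    by rewrite size_drop (size_avoiders213 wA); lia.
  have := mem_avoiders213_cat_min m (take l w) (drop l.+1 w).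
  by rewrite wE lE rE wA => /esym/andP[uA vA]; exists (take l w, drop l.+1 w).
case=> -[u v] [/= uA vA ->].
have [uE vE] := (size_avoiders213 uA, size_avoiders213 vA).
split; last by have := mem_avoiders213_cat_min m u v; rewrite uE vE uA vA.
have /negPf mu : m \notin u by apply/negP => /(mem_avoiders213_bounds uA); lia.
by rewrite index_cat mu /= eqxx addn0 uE.
Qed.

Lemma sum_avoiders213 (V : nmodType) (f : seq nat -> V) (n m : nat) :
  (\sum_(w <- avoiders213 n.+1 m) f w =
   \sum_(0 <= l < n.+1) \sum_(u <- avoiders213 l (m.+1 + (n - l)))
     \sum_(v <- avoiders213 (n - l) m.+1) f (u ++ m :: v))%R.
Proof.
rewrite big_seq (partition_big (fun w => inord (index m w) : 'I_n.+1) predT) //=.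
rewrite [RHS]big_mkord; apply: eq_bigr => l _.
have ln : l + (n - l) = n by rewrite subnKC // -ltnS.
rewrite -(big_allpairs_dep (h := fun u v => u ++ m :: v) (F := f)).
rewrite -(perm_big _ (perm_avoiders213_index m l (n - l))) ln big_filter.
rewrite [RHS]big_seq_cond; apply: eq_bigl => w.
case: (boolP (w \in _)) => //= wA; rewrite -val_eqE /= inordK //.
by rewrite -(size_avoiders213 wA) index_mem (min_mem_avoiders213 wA).
Qed.

(** * The common recurrence *)

Local Open Scope ring_scope.

Section GammaExpansion.

Variables (K : comNzRingType) (t q : K).

Definition quadratic_rec (f : seq nat -> K) : Prop :=
  forall n m, (0 < m)%N ->
  \sum_(w <- avoiders213 n.+2 m) f w =
  (1 + t) * \sum_(w <- avoiders213 n.+1 m.+1) f w +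
  t * \sum_(1 <= l < n.+1) q ^+ (l * (n.+1 - l).+1) *
    ((\sum_(u <- avoiders213 l (m.+1 + (n.+1 - l))) f u) *
     \sum_(v <- avoiders213 (n.+1 - l) m.+1) f v).

Lemma quadratic_rec_of_cat (f : seq nat -> K) (a b : K) : a + b = 1 + t ->
    (forall (m : nat) (w : seq nat), (0 < m)%N -> w != [::] -> all (ltn m) w ->
      f (m :: w) = a * f w) ->
    (forall (m : nat) (w : seq nat), (0 < m)%N -> w != [::] -> all (ltn m) w ->
      f (rcons w m) = b * f w) ->
    (forall (m : nat) (u v : seq nat), (0 < m)%N -> u != [::] -> v != [::] ->
      all (ltn m) (u ++ v) -> allrel ltn v u ->
      f (u ++ m :: v) = t * q ^+ (size u * (size v).+1) * (f u * f v)) ->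
  quadratic_rec f.
Proof.
move=> ab f_cons f_rcons f_cat n m m_gt0.
have avoiders0 k : avoiders213 0 k = [:: [::]] by [].
have nonempty r k (w : seq nat) : (0 < r)%N -> w \in avoiders213 r k -> w != [::].
  by move=> r_gt0 /size_avoiders213 wr; rewrite -size_eq0 wr -lt0n.
have above w : w \in avoiders213 n.+1 m.+1 -> all (ltn m) w.
  by move=> wA; apply/allP => x /(mem_avoiders213_bounds wA)/andP[].
rewrite sum_avoiders213 big_nat_recr // big_ltn //= subn0 subnn addn0.
rewrite avoiders0 big_seq1 -ab mulrDl addrAC; congr (_ + _ + _).
- rewrite mulr_sumr; apply: eq_big_seq => w wA.
  by rewrite f_cons ?above // (nonempty _ _ _ _ wA).
- rewrite mulr_sumr; apply: eq_big_seq => w wA.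
  by rewrite big_seq1 cats1 f_rcons ?above // (nonempty _ _ _ _ wA).
rewrite mulr_sumr; apply: eq_big_nat => l /andP[l_gt0 ln].
rewrite mulrA mulr_suml mulr_sumr; apply: eq_big_seq => u uA.
rewrite 2!mulr_sumr; apply: eq_big_seq => v vA.
rewrite f_cat // ?(size_avoiders213 uA) ?(size_avoiders213 vA) //.
- exact: nonempty uA.
- by apply: nonempty vA; rewrite subn_gt0.
- apply/allP => x; rewrite mem_cat /=.
  by case/orP=> [/(mem_avoiders213_bounds uA)|/(mem_avoiders213_bounds vA)]; lia.
- exact: allrel_avoiders213 uA vA.
Qed.

Lemma eq_sum_quadratic_rec (f g : seq nat -> K) :
    quadratic_rec f -> quadratic_rec g ->
    f [::] = g [::] -> (forall m, f [:: m] = g [:: m]) ->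
  forall n m, (0 < m)%N ->
    \sum_(w <- avoiders213 n m) f w = \sum_(w <- avoiders213 n m) g w.
Proof.
move=> f_rec g_rec fg0 fg1; elim/ltn_ind => -[|[|n]] IH m m_gt0.
- by rewrite !big_seq1.
- by rewrite !sum_avoiders213 !big_nat1 !big_seq1 fg1.
rewrite f_rec // g_rec // IH //; congr (_ + t * _).
by apply: eq_big_nat => l ln; rewrite !IH //; lia.
Qed.

Definition weight (w : seq nat) : K := t ^+ wdes w * q ^+ wadi w.

(* On a nonempty word without double descents, neither subtraction truncates:
   see [double_wdes_lt_size]. *)
Definition gamma_weight (w : seq nat) : K :=
  if wdd 0 w == 0%N then
    q ^+ wadi w * t ^+ wdes w * (1 + t) ^+ ((size w).-1 - (wdes w).*2)
  else 0.

Lemma weight_rec : quadratic_rec weight.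
Proof.
have weight_cat m u v : all (ltn m) (u ++ v) -> allrel ltn v u ->
    weight (u ++ m :: v) = t ^+ (0 < size u)%N *
      q ^+ (size u * (size v + (0 < size v))) * (weight u * weight v).
  by move=> muv vu; rewrite /weight wdes_cat_min // wadi_cat_min // !exprD; ring.
have weight_nil : weight [::] = 1 by rewrite /weight /= mul1r.
apply: (@quadratic_rec_of_cat _ 1 t) => //.
- by move=> m w _ _ mw; rewrite (weight_cat m [::]) ?allrel0r // weight_nil; ring.
- move=> m w _ w0 mw; rewrite -cats1 weight_cat ?cats0 // weight_nil.
  by rewrite lt0n size_eq0 w0 muln0; ring.
- by move=> m u v _ u0 v0 muv vu; rewrite weight_cat // !lt0n !size_eq0 u0 v0 addn1.
Qed.

Lemma gamma_weight_rec : quadratic_rec gamma_weight.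
Proof.
have double_wdes_lt (m : nat) (w : seq nat) : w != [::] -> all (ltn m) w ->
    wdd 0 w = 0%N -> ((wdes w).*2 < size w)%N.
  move=> w0 mw; apply: double_wdes_lt_size w0 _.
  by apply: sub_all mw => x; exact: leq_ltn_trans.
apply: (@quadratic_rec_of_cat _ (1 + t) 0); first exact: addr0.
- move=> m w m0 w0 mw; rewrite /gamma_weight.
  rewrite (wdd_cat_min (u := [::])) // (wdes_cat_min (u := [::])) //.
  rewrite (wadi_cat_min (u := [::])) ?allrel0r //= !addn0 !add0n.
  case: eqP => [dd0|_]; last by rewrite mulr0.
  have wdes_w := double_wdes_lt m w w0 mw dd0.
  rewrite (_ : (size w - _)%N = ((size w).-1 - (wdes w).*2).+1); last by lia.
  by rewrite exprS; ring.
- move=> m w m0 w0 mw; rewrite /gamma_weight -cats1 wdd_cat_min ?cats0 //.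
  by rewrite lt0n size_eq0 w0 addn_eq0 andbF mul0r.
- move=> m u v m0 u0 v0 muv vu; rewrite /gamma_weight wdd_cat_min //.
  rewrite wdes_cat_min // wadi_cat_min // !lt0n !size_eq0 u0.
  rewrite (negPf v0) addn0 addn_eq0.
  case: eqP => [ddu|_]; last by rewrite mul0r mulr0.
  case: eqP => [ddv|_]; last by rewrite !mulr0.
  move: muv; rewrite all_cat => /andP[mu mv].
  have wdes_u := double_wdes_lt m u u0 mu ddu.
  have wdes_v := double_wdes_lt m v v0 mv ddv.
  rewrite size_cat /= addn1 (_ : (_ - _)%N =
    ((size u).-1 - (wdes u).*2 + ((size v).-1 - (wdes v).*2))%N); last by lia.
  by rewrite !exprD exprS; ring.
Qed.

End GammaExpansion.

Local Close Scope ring_scope.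

(** * Permutations as words *)

Lemma wdesE (w : seq nat) :
  wdes w = \sum_(i < (size w).-1) (nth 0 w i.+1 < nth 0 w i : nat).
Proof.
elim: w => [|x [|y w] IH]; first by rewrite big_ord0.
  by rewrite big_ord0 /= ltnn.
by rewrite big_ord_recl -[LHS]/((y < x) + wdes (y :: w)) IH.
Qed.

Lemma wddE (a : nat) (w : seq nat) :
  wdd a w = \sum_(i < size w)
    ((nth 0 w i < nth 0 (a :: w) i) && (nth 0 w i.+1 < nth 0 w i) : nat).
Proof.
elim: w a => [|x w IH] a /=; first by rewrite big_ord0.
by rewrite big_ord_recl IH /= nth0.
Qed.

Lemma wadi_fromE (x : nat) (s w : seq nat) :
  wadi_from x s w = \sum_(j < size w) ((nth 0 w j < x) &&
    ((nth 0 w j < nth 0 w j.+1) || has (ltn^~ (nth 0 w j)) (s ++ take j w)) : nat).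
Proof.
elim: w s => [|y w IH] s /=; first by rewrite big_ord0.
rewrite big_ord_recl IH /= cats0 nth0.
congr (_ + _); apply: eq_bigr => j _; congr (nat_of_bool (_ && (_ || _))).
by rewrite !has_cat /= orbCA orbA.
Qed.

Lemma wadiE (w : seq nat) :
  wadi w = \sum_(i < size w) wadi_from (nth 0 w i) [::] (drop i.+1 w).
Proof.
elim: w => [|x w IH] /=; first by rewrite big_ord0.
by rewrite big_ord_recl IH /= drop0.
Qed.

Lemma wavoids213P (w : seq nat) :
  reflect (forall i j k, i < j -> j < k -> k < size w ->
             ~~ (nth 0 w j < nth 0 w i < nth 0 w k))
          (wavoids213 w).
Proof.
elim: w => [|x w IH] /=; first by left.
apply: (iffP andP) => [[/(pairwiseP 0) xw /IH ww] [|i] [|j] [|k] //|ww].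
- by move=> _ jk kw; apply: xw => //; rewrite inE; lia.
- exact: ww i j k.
split; last by apply/IH => i j k; apply: (ww i.+1 j.+1 k.+1).
by apply/(pairwiseP 0) => j k _ kw jk; apply: (ww 0 j.+1 k.+1).
Qed.

Local Arguments pv : simpl never.

Lemma pv_ord (n : nat) (s : 'S_n) (b : nat) (i : 'I_n) : pv s b i.+1 = (s i).+1.
Proof. by rewrite /pv valK. Qed.

Lemma pv_gt (n : nat) (s : 'S_n) (b i : nat) : n < i -> pv s b i = b.
Proof. by case: i => // i ni; rewrite /pv insubN // -leqNgt. Qed.

Definition word (n : nat) (s : 'S_n) : seq nat := [seq (s i).+1 | i <- enum 'I_n].

Lemma size_word (n : nat) (s : 'S_n) : size (word s) = n.
Proof. by rewrite size_map size_enum_ord. Qed.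

Lemma pv_word (n : nat) (s : 'S_n) (i : nat) : pv s 0 i = nth 0 (0 :: word s) i.
Proof.
case: i => // i; have [i_n|n_i] := ltnP i n; last first.
  by rewrite pv_gt // nth_default //= size_word.
rewrite (@pv_ord _ _ _ (Ordinal i_n)) /= (nth_map (Ordinal i_n)) ?size_enum_ord //.
by rewrite (nth_ord_enum _ (Ordinal i_n)).
Qed.

Lemma nth_word (n : nat) (s : 'S_n) (i : 'I_n) : nth 0 (word s) i = (s i).+1.
Proof. by rewrite -(pv_ord s 0) pv_word. Qed.

Lemma des_word (n : nat) (s : 'S_n) : des s = wdes (word s).
Proof.
rewrite wdesE size_word /des big_add1 big_mkord.
by apply: eq_bigr => i _; rewrite !pv_word.
Qed.

Lemma dd_word (n : nat) (s : 'S_n) : dd s = wdd 0 (word s).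
Proof.
rewrite wddE size_word /dd big_add1 big_mkord.
by apply: eq_bigr => i _; rewrite !pv_word.
Qed.

Lemma adi_word (n : nat) (s : 'S_n) : adi s = wadi (word s).
Proof.
rewrite wadiE size_word /adi big_add1 big_mkord; apply: eq_bigr => i _.
rewrite wadi_fromE size_drop size_word -[i.+2]add0n big_addn big_mkord /=.
rewrite subSS; apply: eq_bigr => j _.
rewrite !addnS !nth_drop !pv_word /= !addSn !addnS addnC.
congr (nat_of_bool (_ && (_ || _))).
rewrite -(map_nth_iota 0) ?size_word 1?ltnW //.
rewrite /index_iota !subSS addKn -[i.+2]add1n iotaDl !has_map.
by apply: eq_has => l /=; rewrite pv_word.
Qed.

Lemma word_inj (n : nat) : injective (@word n).
Proof.
move=> s s' E; apply/permP => i; apply/val_inj.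
by have := congr1 (nth 0 ^~ i) E; rewrite !nth_word => -[].
Qed.

Lemma perm_word (n : nat) (s : 'S_n) : perm_eq (word s) (iota 1 n).
Proof.
have -> : iota 1 n = [seq i.+1 | i <- [seq val i | i <- enum 'I_n]].
  by rewrite val_enum_ord (iotaDl 1 0).
have -> : word s = [seq i.+1 | i <- [seq val i | i <- [seq s i | i <- enum 'I_n]]].
  by rewrite /word -!map_comp.
do 2!apply: perm_map; apply: uniq_perm; last 1 first.
- by move=> i; rewrite mem_enum -[i](permKV s) map_f ?mem_enum.
- by rewrite map_inj_uniq ?enum_uniq //; exact: perm_inj.
exact: enum_uniq.
Qed.

Lemma perm_map_word (n : nat) :
  perm_eq [seq word s | s <- enum 'S_n] (permutations (iota 1 n)).
Proof.
have uw : uniq [seq word s | s <- enum 'S_n].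
  by rewrite map_inj_uniq ?enum_uniq //; exact: word_inj.
apply: uniq_perm => //; first exact: permutations_uniq.
have [] // := uniq_min_size uw (s2 := permutations (iota 1 n)).
  by move=> _ /mapP[s _ ->]; rewrite mem_permutations perm_word.
by rewrite size_permutations ?iota_uniq // size_iota size_map -cardE card_Sn.
Qed.

Lemma contains213P (n : nat) (s : 'S_n) :
  reflect (exists i j k : 'I_n, [/\ i < j, j < k, s j < s i & s i < s k])
          (contains s [:: 2; 1; 3]).
Proof.
apply: (iffP existsP) => /= [[f /forallP fP]|[i [j [k [ij jk ji ik]]]]].
  pose o0 : 'I_3 := inord 0; pose o1 : 'I_3 := inord 1; pose o2 : 'I_3 := inord 2.
  move: (fP o0) (fP o1) => /forallP f0 /forallP f1.
  exists (f o0), (f o1), (f o2); move: (f0 o1) (f0 o2) (f1 o0) (f1 o2).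
  by rewrite /= !inordK //= => ? ? ? ?; split; lia.
exists [ffun a : 'I_3 => nth i [:: i; j; k] a].
apply/forallP => -[[|[|[|//]]] a3]; apply/forallP => -[[|[|[|//]]] b3];
  by rewrite /= !ffunE /=; lia.
Qed.

Lemma avoids_word (n : nat) (s : 'S_n) :
  avoids s [:: 2; 1; 3] = wavoids213 (word s).
Proof.
rewrite /avoids; apply/idP/wavoids213P => [/contains213P avs i j k ij jk|avs].
  rewrite size_word => k_n; have j_n := ltn_trans jk k_n.
  have i_n := ltn_trans ij j_n.
  rewrite (nth_word s (Ordinal i_n)) (nth_word s (Ordinal j_n)).
  rewrite (nth_word s (Ordinal k_n)) !ltnS; apply/negP => /andP[ji ik].
  by apply: avs; exists (Ordinal i_n), (Ordinal j_n), (Ordinal k_n).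
apply/contains213P => -[i [j [k [ij jk ji ik]]]].
have := avs i j k ij jk; rewrite size_word !nth_word !ltnS ji ik.
by move/(_ (ltn_ord k)).
Qed.

Lemma sum_avoids_word (V : nmodType) (n : nat) (f : seq nat -> V) :
  (\sum_(s : 'S_n | avoids s [:: 2; 1; 3]%N) f (word s) =
   \sum_(w <- avoiders213 n 1) f w)%R.
Proof.
rewrite big_filter -(perm_big _ (perm_map_word n)) big_map big_enum_cond /=.
by apply: eq_bigl => s; rewrite avoids_word.
Qed.

Lemma double_des_leq (n : nat) (s : 'S_n) : dd s = 0 -> (des s).*2 <= n.-1.
Proof.
case: n s => [|n] s; first by rewrite /des big_geq.
rewrite dd_word des_word => /double_wdes_lt_size; rewrite size_word; apply.
  by rewrite -size_eq0 size_word.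
by apply/allP => x; rewrite (perm_mem (perm_word s)) mem_iota => /andP[].
Qed.

(** * Reverse complement *)

Definition revcomp_pattern (tau : seq nat) : seq nat :=
  [seq (size tau).+1 - x | x <- rev tau].

Definition revcomp (n : nat) (s : 'S_n) : 'S_n :=
  (perm (@rev_ord_inj n) * s * perm (@rev_ord_inj n))%g.

Lemma revcompE (n : nat) (s : 'S_n) (i : 'I_n) :
  revcomp s i = rev_ord (s (rev_ord i)).
Proof. by rewrite !permM !permE. Qed.

Lemma revcompK (n : nat) : involutive (@revcomp n).
Proof. by move=> s; apply/permP => i; rewrite !revcompE !rev_ordK. Qed.

Lemma size_revcomp_pattern (tau : seq nat) : size (revcomp_pattern tau) = size tau.
Proof. by rewrite size_map size_rev. Qed.

Lemma nth_revcomp_pattern (tau : seq nat) (a : nat) : a < size tau ->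
  nth 0 (revcomp_pattern tau) a = (size tau).+1 - nth 0 tau (size tau - a.+1).
Proof. by move=> a_lt; rewrite (nth_map 0) ?size_rev // nth_rev. Qed.

Lemma revcomp_patternK (tau : seq nat) :
  all (leq^~ (size tau).+1) tau -> revcomp_pattern (revcomp_pattern tau) = tau.
Proof.
move=> tau_le; rewrite /revcomp_pattern -map_rev revK size_map size_rev -map_comp.
by rewrite map_id_in // => x /(allP tau_le) /=; exact: subKn.
Qed.

Lemma contains_revcomp (n : nat) (s : 'S_n) (tau : seq nat) :
  all (leq^~ (size tau).+1) tau -> contains s tau ->
  contains (revcomp s) (revcomp_pattern tau).
Proof.
move=> tau_le /existsP[f /forallP fP].
pose flip a := rev_ord (cast_ord (size_revcomp_pattern tau) a).
apply/existsP; exists [ffun a => rev_ord (f (flip a))].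
apply/forallP => a; apply/forallP => b.
have [a_lt b_lt] : a < size tau /\ b < size tau.
  by rewrite -[size tau]size_revcomp_pattern.
have nth_le c : nth 0 tau c <= (size tau).+1.
  case: (ltnP c (size tau)) => [c_lt|?]; last by rewrite nth_default.
  exact: allP tau_le _ (mem_nth 0 c_lt).
have /forallP/(_ (flip a)) := fP (flip b).
by rewrite !ffunE !revcompE !rev_ordK !nth_revcomp_pattern //= !ltn_sub2lE.
Qed.

Lemma avoids_revcomp (n : nat) (s : 'S_n) (tau : seq nat) :
  all (leq^~ (size tau).+1) tau ->
  avoids (revcomp s) (revcomp_pattern tau) = avoids s tau.
Proof.
move=> tau_le; congr (~~ _); apply/idP/idP; last exact: contains_revcomp.
move/contains_revcomp; rewrite revcompK revcomp_patternK //; apply.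
apply/allP => x /mapP[y _ ->]; rewrite size_revcomp_pattern; exact: leq_subr.
Qed.

Lemma pv_revcomp (n : nat) (s : 'S_n) (i : nat) :
  i <= n.+1 -> pv (revcomp s) n.+1 i = n.+1 - pv s 0 (n.+1 - i).
Proof.
case: i => [|i]; first by rewrite subn0 (@pv_gt _ _ _ n.+1).
rewrite ltnS leq_eqVlt => /orP[/eqP->|i_n]; first by rewrite pv_gt // subnn.
have -> : n.+1 - i.+1 = (rev_ord (Ordinal i_n)).+1 by rewrite /=; lia.
by rewrite (@pv_ord _ _ _ (Ordinal i_n)) pv_ord revcompE /= subnSK.
Qed.

Lemma pv_le (n : nat) (s : 'S_n) (i : nat) : pv s 0 i <= n.
Proof.
case: (ltnP n i) => [/pv_gt-> //|]; case: i => // i i_n.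
by rewrite (@pv_ord _ _ _ (Ordinal i_n)).
Qed.

Lemma ltn_pv_revcomp (n : nat) (s : 'S_n) (i j : nat) : i <= n.+1 -> j <= n.+1 ->
  (pv (revcomp s) n.+1 i < pv (revcomp s) n.+1 j) =
  (pv s 0 (n.+1 - j) < pv s 0 (n.+1 - i)).
Proof.
by move=> i_n j_n; rewrite !pv_revcomp // ltn_sub2lE // leqW ?pv_le.
Qed.

Lemma pv_inside (n : nat) (s : 'S_n) (b i : nat) :
  0 < i <= n -> pv s b i = pv s 0 i.
Proof. by case: i => // i /= i_n; rewrite /pv insubT. Qed.

Lemma des_revcomp (n : nat) (s : 'S_n) : des (revcomp s) = des s.
Proof.
rewrite [RHS]/des big_nat_rev; apply: eq_big_nat => i /andP[i0 i_n].
rewrite -!(@pv_inside _ (revcomp s) n.+1) ?ltn_pv_revcomp; try lia.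
have -> : (1 + n - i.+1).+1 = n.+1 - i by lia.
by have -> : 1 + n - i.+1 = n.+1 - i.+1 by lia.
Qed.

Lemma dd_star_revcomp (n : nat) (s : 'S_n) : dd_star (revcomp s) = dd s.
Proof.
rewrite [RHS]/dd big_nat_rev; apply: eq_big_nat => i /andP[i0 i_n].
rewrite !ltn_pv_revcomp; try lia.
have -> : (1 + n.+1 - i.+1).+1 = n.+1 - i.-1 by lia.
have -> : (1 + n.+1 - i.+1).-1 = n.+1 - i.+1 by lia.
have -> : 1 + n.+1 - i.+1 = n.+1 - i by lia.
by rewrite andbC.
Qed.

Lemma big_triangle_rev (T : Type) (idx : T) (op : Monoid.com_law idx) (n : nat)
    (F : nat -> nat -> T) :
  \big[op/idx]_(1 <= i < n.+1) \big[op/idx]_(i.+1 <= j < n.+1) F i j =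
  \big[op/idx]_(1 <= i < n.+1)
    \big[op/idx]_(i.+1 <= j < n.+1) F (n.+1 - j) (n.+1 - i).
Proof.
have square (G : nat -> nat -> T) :
    \big[op/idx]_(1 <= i < n.+1) \big[op/idx]_(i.+1 <= j < n.+1) G i j =
    \big[op/idx]_(1 <= i < n.+1)
      \big[op/idx]_(1 <= j < n.+1) (if i < j then G i j else idx).
  by apply: eq_bigr => i _; rewrite -big_mkcond /= [LHS](big_nat_widenl _ 1).
rewrite !square [RHS]exchange_big_nat [RHS]big_nat_rev /=.
apply: eq_big_nat => i iB; rewrite [RHS]big_nat_rev /=.
apply: eq_big_nat => j jB.
have -> : (1 + n.+1 - j.+1 < 1 + n.+1 - i.+1) = (i < j) by lia.
by case: ifP => // _; congr F; lia.
Qed.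

Lemma adi_star_revcomp (n : nat) (s : 'S_n) : adi_star (revcomp s) = adi s.
Proof.
rewrite /adi_star /adi /= [RHS]big_triangle_rev.
apply: eq_big_nat => i /andP[i0 i_n]; apply: eq_big_nat => j /andP[ij j_n].
rewrite !ltn_pv_revcomp; try lia.
have -> : (n.+1 - i).+1 = n.+1 - i.-1 by lia.
congr (nat_of_bool (_ && (_ || _))).
apply/hasP/hasP => -[l]; rewrite mem_index_iota => lB.
  rewrite ltn_pv_revcomp; try lia.
  by exists (n.+1 - l) => //; rewrite mem_index_iota; lia.
exists (n.+1 - l); first by rewrite mem_index_iota; lia.
rewrite ltn_pv_revcomp; try lia.
by rewrite subKn //; lia.
Qed.

Local Open Scope ring_scope.

Lemma sum_avoids213_weight (K : comNzRingType) (n : nat) (t q : K) :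
  \sum_(s : 'S_n | avoids s [:: 2; 1; 3]%N) t ^+ des s * q ^+ adi s =
  \sum_(w <- avoiders213 n 1) weight t q w.
Proof.
by rewrite -sum_avoids_word; apply: eq_bigr => s _; rewrite des_word adi_word.
Qed.

Lemma sum_Stilde213_gamma_weight (K : comNzRingType) (n : nat) (t q : K) :
  \sum_(0 <= k < (n.-1)./2.+1)
     (\sum_(s : 'S_n | Stilde213 k s) q ^+ adi s)
       * t ^+ k * (1 + t) ^+ (n.-1 - k.*2) =
  \sum_(w <- avoiders213 n 1) gamma_weight t q w.
Proof.
rewrite -sum_avoids_word.
under eq_bigr => k _ do rewrite -mulrA mulr_suml.
rewrite (exchange_big_dep (fun s : 'S_n => avoids s [:: 2; 1; 3]%N)) /=; last first.
  by move=> k s _ /and3P[].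
apply: eq_bigr => s avs; rewrite /gamma_weight -dd_word -des_word -adi_word size_word.
case: eqP => [dd0|/eqP/negPf dd0]; last first.
  by rewrite big_pred0 // => k; rewrite /Stilde213 dd0 andbF.
rewrite (eq_bigl (pred1 (des s))) => [|k]; last first.
  by rewrite /Stilde213 avs dd0 eqxx /= eq_sym.
by rewrite big_nat1_eq ltnS geq_half_double double_des_leq // mulrA.
Qed.

Theorem theorem1p3 (R : comNzRingType) (n : nat) (t q : R) : (1 <= n)%N ->
  let A := \sum_(s : 'S_n | avoids s [:: 2; 1; 3]%N) t ^+ des s * q ^+ adi s in
  let B := \sum_(s : 'S_n | avoids s [:: 1; 3; 2]%N) t ^+ des s * q ^+ adi_star s in
  let C := \sum_(0 <= k < (n.-1)./2.+1)
             (\sum_(s : 'S_n | Stilde213 k s) q ^+ adi s)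
               * t ^+ k * (1 + t) ^+ (n.-1 - k.*2) in
  let D := \sum_(0 <= k < (n.-1)./2.+1)
             (\sum_(s : 'S_n | Stilde132 k s) q ^+ adi_star s)
               * t ^+ k * (1 + t) ^+ (n.-1 - k.*2) in
  [/\ A = B, B = C & C = D].
Proof.
move=> _ A B C D.
have avoids132 (s : 'S_n) : avoids (revcomp s) [:: 1; 3; 2]%N =
    avoids s [:: 2; 1; 3]%N.
  exact: (@avoids_revcomp _ _ [:: 2; 1; 3]%N).
have AB : A = B.
  rewrite /B (reindex_inj (can_inj (@revcompK n))) /=.
  apply: eq_big => s; first by rewrite avoids132.
  by rewrite des_revcomp adi_star_revcomp.
have CD : C = D.
  apply: eq_bigr => k _; congr (_ * _ * _).
  rewrite [RHS](reindex_inj (can_inj (@revcompK n))) /=.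
  apply: eq_big => s; last by rewrite adi_star_revcomp.
  by rewrite /Stilde132 avoids132 des_revcomp dd_star_revcomp.
split=> //; rewrite -AB /A /C sum_avoids213_weight sum_Stilde213_gamma_weight.
apply: eq_sum_quadratic_rec => //; first exact: weight_rec.
- exact: gamma_weight_rec.
- by rewrite /weight /gamma_weight /= !expr0 !mulr1.
by move=> m; rewrite /weight /gamma_weight /= ltnn !expr0 !mulr1.
Qed.
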